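(* For $s,t\in\mathbb{R}$ let $A_\infty(s,t)=\big[\min\{i,j\}+s+t\,\delta_{i,j}\big]_{i,j=1}^\infty$. Then $A_\infty(s,t)$ is positive definite if and only if \[ 1+4t\ge0\qquad\text{and}\qquad 1+2s+\sqrt{1+4t}\ge0. \]
   Context: $\delta_{i,j}$ is the Kronecker delta. An infinite real symmetric matrix $[a_{ij}]_{i,j\ge1}$ is called positive definite if $\sum_{i,j}a_{ij}x_ix_j\ge0$ for every finitely supported real sequence $(x_i)$, equivalently every finite leading block $[a_{ij}]_{i,j=1}^n$ has all eigenvalues $\ge0$ (i.e. positive semidefinite in the usual terminology). *)

(* Defs.v *)
From mathcomp Require Import all_boot all_order all_algebra.
From mathcomp Require Import reals.
Set Implicit Arguments.
Unset Strict Implicit.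
Unset Printing Implicit Defensive.
Import Order.TTheory GRing.Theory Num.Theory.
Local Open Scope ring_scope.

(* An infinite matrix [a_ij]_{i,j >= 1} is a function nat -> nat -> R of which
   only the entries with positive indices are meaningful; likewise a sequence
   (x_i)_{i >= 1} is a function nat -> R whose value at 0 is ignored. *)

Definition symmetric_infmx (R : realType) (a : nat -> nat -> R) : Prop :=
  forall i j : nat, (0 < i)%N -> (0 < j)%N -> a i j = a j i.

(* The inequality is weak, so that "definite" here means "semidefinite" in the
   usual terminology. The double series reduces to the sum over any range
   1 <= i, j <= n outside of which x vanishes. *)
Definition posdef_infmx (R : realType) (a : nat -> nat -> R) : Prop :=
  symmetric_infmx a /\
  forall (x : nat -> R) (n : nat),
    (forall i : nat, (n < i)%N -> x i = 0) ->
    0 <= \sum_(1 <= i < n.+1) \sum_(1 <= j < n.+1) a i j * x i * x j.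

Definition A_infty (R : realType) (s t : R) (i j : nat) : R :=
  (minn i j)%:R + s + t * (i == j)%:R.

(* Main.v *)
Require Import Defs.
From mathcomp Require Import all_boot all_order all_algebra.
From mathcomp Require Import reals.
From mathcomp Require Import ring lra.
Import Order.TTheory GRing.Theory Num.Theory.
Local Open Scope ring_scope.

(** In terms of the tail sums u_k = x_k + x_(k+1) + ..., the quadratic form is
    sum_k u_k^2 + s u_1^2 + t sum_k (u_k - u_(k+1))^2. Alternating u force
    1 + 4t >= 0. If r = sqrt(1 + 4t), p = (r+1)/2 and q = (r-1)/2, then
    p - q = 1 and pq = t, so the form equals
    sum_k (p u_(k+1) - q u_k)^2 + (p + s) u_1^2, where p + s = (1+2s+r)/2.
    It remains to make the first sum small relative to u_1^2: since
    |q/p| <= 1, this is achieved by u_k = (q/p)^(k-1) (n+1-k), which works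
    uniformly in r >= 0. *)

Lemma quadratic_form_recr (R : realType) (a : nat -> nat -> R) (x : nat -> R)
    (n : nat) : symmetric_infmx a ->
  \sum_(1 <= i < n.+2) \sum_(1 <= j < n.+2) a i j * x i * x j =
  \sum_(1 <= i < n.+1) \sum_(1 <= j < n.+1) a i j * x i * x j
  + 2 * x n.+1 * (\sum_(1 <= j < n.+1) a j n.+1 * x j)
  + a n.+1 n.+1 * x n.+1 ^+ 2.
Proof.
move=> asym; rewrite (big_nat_recr n.+1) //=.
under eq_bigr do rewrite (big_nat_recr n.+1) //=.
rewrite big_split /= (big_nat_recr n.+1) //= mulr_sumr.
rewrite (_ : \sum_(1 <= j < n.+1) 2 * x n.+1 * (a j n.+1 * x j) =
  \sum_(1 <= j < n.+1) a j n.+1 * x j * x n.+1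
  + \sum_(1 <= j < n.+1) a n.+1 j * x n.+1 * x j); first by ring.
rewrite -big_split; apply: eq_big_nat => j /andP[j0 _] /=.
by rewrite (asym n.+1 j) //; ring.
Qed.

Lemma A_infty_sym (R : realType) (s t : R) : symmetric_infmx (A_infty s t).
Proof. by move=> i j _ _; rewrite /A_infty minnC eq_sym. Qed.

(** Above the diagonal the entry is [j + s], whatever [m] is, so Abel summation applies. *)
Lemma A_infty_column_sum (R : realType) (s t : R) (u : nat -> R) (n m : nat) :
  (n < m)%N ->
  \sum_(1 <= j < n.+1) A_infty s t j m * (u j - u j.+1) =
  \sum_(1 <= k < n.+1) u k - n%:R * u n.+1 + s * (u 1%N - u n.+1).
Proof.
elim: n => [|n IHn] nm; first by rewrite !big_geq //; ring.
rewrite !(big_nat_recr n.+1) //= IHn ?(ltnW nm) // /A_infty.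
rewrite (minn_idPl (ltnW nm)) (ltn_eqF nm) mulr0n -!natr1; ring.
Qed.

(** The boundary value [u n.+1] is kept arbitrary so that induction on [n] goes through; its terms
    drop out once it is zero. *)
Lemma A_infty_form_diff (R : realType) (s t : R) (u : nat -> R) (n : nat) :
  \sum_(1 <= i < n.+1) \sum_(1 <= j < n.+1)
    A_infty s t i j * (u i - u i.+1) * (u j - u j.+1) =
  \sum_(1 <= k < n.+1) (u k ^+ 2 + t * (u k - u k.+1) ^+ 2)
  - 2 * u n.+1 * (\sum_(1 <= k < n.+1) u k)
  + n%:R * u n.+1 ^+ 2 + s * (u 1%N - u n.+1) ^+ 2.
Proof.
elim: n => [|n IHn]; first by rewrite !big_geq //; ring.
rewrite (@quadratic_form_recr _ _ (fun i => u i - u i.+1)); last first.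
  exact: A_infty_sym.
rewrite IHn A_infty_column_sum // !(big_nat_recr n.+1) //=.
rewrite /A_infty minnn eqxx mulr1n -!natr1; ring.
Qed.

Lemma posdef_A_infty_tailsP (R : realType) (s t : R) :
  posdef_infmx (A_infty s t) <->
  forall (u : nat -> R) (n : nat), u n.+1 = 0 ->
    0 <= \sum_(1 <= k < n.+1) (u k ^+ 2 + t * (u k - u k.+1) ^+ 2)
         + s * u 1%N ^+ 2.
Proof.
split=> [[_ Apos] u n un0|upos].
  (* Only [u n.+1] is known to vanish, not the later values, hence the truncation. *)
  pose x i := if (i <= n)%N then u i - u i.+1 else 0.
  have /(Apos x) : forall i, (n < i)%N -> x i = 0.
    by move=> i; rewrite /x ltnNge => /negbTE ->.
  have xE i : (1 <= i < n.+1)%N -> x i = u i - u i.+1.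
    by rewrite /x ltnS => /andP[_ ->].
  suff -> : \sum_(1 <= i < n.+1) \sum_(1 <= j < n.+1)
      A_infty s t i j * x i * x j =
    \sum_(1 <= i < n.+1) \sum_(1 <= j < n.+1)
      A_infty s t i j * (u i - u i.+1) * (u j - u j.+1).
    by rewrite A_infty_form_diff un0 !(mulr0, mul0r, subr0, addr0, expr0n).
  by do 2!(apply: eq_big_nat => ? ?); rewrite !xE.
split=> [|x n _]; first exact: A_infty_sym.
pose u k := \sum_(k <= i < n.+1) x i.
have un0 : u n.+1 = 0 by rewrite /u big_geq.
have xE i : (1 <= i < n.+1)%N -> x i = u i - u i.+1.
  by move=> /andP[_ ilen]; rewrite /u (big_ltn ilen) addrK.
have := upos u n un0.
suff -> : \sum_(1 <= i < n.+1) \sum_(1 <= j < n.+1)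
    A_infty s t i j * x i * x j =
  \sum_(1 <= i < n.+1) \sum_(1 <= j < n.+1)
    A_infty s t i j * (u i - u i.+1) * (u j - u j.+1).
  by rewrite A_infty_form_diff un0 !(mulr0, mul0r, subr0, addr0, expr0n).
by do 2!(apply: eq_big_nat => ? ?); rewrite !xE.
Qed.

(** For [p = q + 1] the k-th summands differ by [p * (u k ^+ 2 - u k.+1 ^+ 2)], which telescopes. *)
Lemma tail_form_squares (R : realType) (p q : R) (u : nat -> R) (n : nat) :
  p - q = 1 ->
  \sum_(1 <= k < n.+1) (u k ^+ 2 + p * q * (u k - u k.+1) ^+ 2) =
  \sum_(1 <= k < n.+1) (p * u k.+1 - q * u k) ^+ 2
  + p * (u 1%N ^+ 2 - u n.+1 ^+ 2).
Proof.
move=> pq1; have -> : p = q + 1 by rewrite -pq1; ring.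
elim: n => [|n IHn]; first by rewrite !big_geq //; ring.
rewrite !(big_nat_recr n.+1) //= IHn; ring.
Qed.

(** Each sign change contributes [1 + 4 * t]; the final drop to zero contributes [1 + t]. *)
Lemma alternating_tail_form (R : realType) (t : R) (n : nat) :
  let u k : R := if (k <= n.+1)%N then (-1) ^+ k else 0 in
  \sum_(1 <= k < n.+2) (u k ^+ 2 + t * (u k - u k.+1) ^+ 2) =
  n%:R * (1 + 4 * t) + 1 + t.
Proof.
move=> u; rewrite (big_nat_recr n.+1) //=.
have -> : u n.+2 = 0 by rewrite /u ltnn.
have -> : u n.+1 = (-1) ^+ n.+1 by rewrite /u leqnn.
rewrite subr0 sqrr_sign.
rewrite (@eq_big_nat _ _ _ _ _ _ (fun=> 1 + 4 * t)).
  by rewrite sumr_const_nat subn1 /= -mulr_natl; ring.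
move=> k /andP[_ kn]; rewrite /u kn ltnW // (exprS _ k).
have := sqrr_sign R k; set e : R := (-1) ^+ k => e2.
by rewrite (_ : e - -1 * e = 2 * e) ?exprMn ?e2; ring.
Qed.

(** Archimedean property: if [a < 0], any integer [n > b / - a] makes the expression negative. *)
Lemma slope_ge0 (R : realType) (a b : R) :
  (forall n : nat, 0 <= n%:R * a + b) -> 0 <= a.
Proof.
move=> ab; rewrite leNgt; apply/negP => a0.
have := ab (Num.truncn (b / - a)).+1.
have na0 : 0 < - a by rewrite oppr_gt0.
have := truncnS_gt (b / - a).
rewrite ltr_pdivrMr // mulrN; lra.
Qed.

Theorem theorem3p4 (R : realType) (s t : R) :
  posdef_infmx (A_infty s t) <->
  (0 <= 1 + 4 * t /\ 0 <= 1 + 2 * s + Num.sqrt (1 + 4 * t)).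
Proof.
set r := Num.sqrt (1 + 4 * t).
have r0 : 0 <= r by exact: sqrtr_ge0.
pose p := (r + 1) / 2; pose q := (r - 1) / 2.
have pq1 : p - q = 1 by rewrite /p /q; field.
have psE : p + s = (1 + 2 * s + r) / 2 by rewrite /p; field.
have tE : 0 <= 1 + 4 * t -> t = p * q.
  by move=> t0; have := sqr_sqrtr t0; rewrite -/r /p /q => r2; nra.
apply: (iff_trans (posdef_A_infty_tailsP _ s t)).
split=> [upos|[t0 c0] u n un0]; last first.
  rewrite (tE t0) tail_form_squares // un0 expr0n subr0 -addrA -mulrDl psE.
  apply: addr_ge0; first by apply: sumr_ge0 => k _; exact: sqr_ge0.
  by apply: mulr_ge0; rewrite ?sqr_ge0 // divr_ge0.
have t0 : 0 <= 1 + 4 * t.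
  apply: (@slope_ge0 _ _ (1 + t + s)) => n.
  have := upos (fun k => if (k <= n.+1)%N then (-1) ^+ k else 0) n.+1.
  rewrite ltnn => /(_ erefl); rewrite alternating_tail_form /= expr1 sqrrN.
  by rewrite expr1n mulr1 !addrA.
split=> //.
have p0 : 0 < p by rewrite /p; lra.
(* This is [|r - 1| <= r + 1], with equality when [r = 0]. *)
have rho1 : (q / p) ^+ 2 <= 1.
  rewrite expr_div_n ler_pdivrMr ?exprn_gt0 // mul1r /p /q; nra.
suff: 0 <= p + s by rewrite psE; lra.
(* The test sequence below will give [0 <= n.+1%:R * (p + s) + q ^+ 2]; the constant absorbs the
   shift from [n.+1] to [n]. *)
apply: (@slope_ge0 _ _ (p + s + q ^+ 2)) => n.
(* The geometric factor alone would annihilate every square; the linear factor makes [u] vanish at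
   [n.+2]. *)
pose u k := (q / p) ^+ k.-1 * (n.+2%:R - k%:R).
have un0 : u n.+2 = 0 by rewrite /u subrr mulr0.
have := upos u n.+1 un0; rewrite [in X in X -> _](tE t0).
rewrite tail_form_squares // un0.
have -> : u 1%N = n.+1%:R by rewrite /u expr0 mul1r -natrB // subn1.
have step k : (1 <= k < n.+2)%N -> (p * u k.+1 - q * u k) ^+ 2 <= q ^+ 2.
  case: k => // k _.
  (* Only the unit decrement of the linear factor survives the cancellation. *)
  rewrite (_ : p * u k.+2 - q * u k.+1 = - (q * (q / p) ^+ k)).
    rewrite sqrrN exprMn ler_piMr ?sqr_ge0 // -exprM mulnC exprM.
    by apply: exprn_ile1; rewrite ?sqr_ge0.
  rewrite /u /= exprS -!natr1; field; exact: lt0r_neq0.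
have : \sum_(1 <= k < n.+2) (p * u k.+1 - q * u k) ^+ 2 <= n.+1%:R * q ^+ 2.
  rewrite (le_trans (ler_sum_nat step)) // sumr_const_nat subn1 /=.
  by rewrite mulr_natl.
rewrite expr0n subr0; set S := \sum_(_ <= _ < _) _ => Sle Sge.
have n0 : 0 < n.+1%:R :> R by rewrite ltr0n.
suff : 0 <= n.+1%:R * (p + s) + q ^+ 2 by rewrite -natr1; lra.
(* Here [u 1 = n.+1], so the squares total at most [n.+1 * q ^+ 2] against [n.+1 ^+ 2 * (p + s)]; a
   factor [n.+1] cancels. *)
rewrite -(pmulr_rge0 _ n0); lra.
Qed.
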